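(* Let $\sigma_{1},\dots,\sigma_{n}$ be weights on $\mathbb{R}^{d}$ and let $\Phi_{1},\dots,\Phi_{n}\in \widetilde{\mathcal{U}}$. Assume that $\Phi$ is a bijection from $\mathbb{R}_{+}$ to itself such that $\Phi^{-1}=\Phi_{1}^{-1}\times\cdots\times \Phi_{n}^{-1}$ (pointwise product). Define $\nu_{\vec{\sigma}}:= \frac{1}{\Phi\left(\prod_{i=1}^{n}\Phi_{i}^{-1}\left(\frac{1}{\sigma_{i}}\right)\right)}$. Then the following assertions hold. (i) There exists a constant $C_{1}=C_{n,\Phi_{1},\dots,\Phi_{n}}>0$ such that $$\Phi\left(\prod_{i=1}^{n}\Phi_{i}^{-1}\left(\frac{1}{\sigma_{i}(Q)}\right)\right)\nu_{\vec{\sigma}}(Q) \leq C_{1}\qquad\text{for all } Q \in \mathcal{Q}.$$ (ii) If $\sigma_{i} \in A_{1}$ for each $1\leq i \leq n$, then there exists a constant $C_{2}=C_{n, \Phi_{1},\dots,\Phi_{n}}>0$ such that $$\frac{C_{2}}{\sum_{i=1}^{n}[\sigma_{i}]_{A_{1}}}\leq\Phi\left(\prod_{i=1}^{n}\Phi_{i}^{-1}\left(\frac{1}{\sigma_{i}(Q)}\right)\right)\nu_{\vec{\sigma}}(Q)\qquad\text{for all } Q \in \mathcal{Q}.$$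
   Context: $\mathbb{R}_+=[0,\infty)$, $\mathbb{R}_+^*=(0,\infty)$. $\mathcal{Q}$ is the set of non-degenerate cubes in $\mathbb{R}^d$ with sides parallel to the axes; $|Q|$ is Lebesgue measure. A weight is a locally integrable, almost everywhere positive function $\sigma$ on $\mathbb{R}^d$; $\sigma(E)=\int_E\sigma(x)\,dx$ (the same notation is used for $\nu_{\vec\sigma}$). A weight $\omega$ is in $A_1$ if $[\omega]_{A_1}:=\sup_{Q\in\mathcal{Q}}\left(\frac{1}{|Q|}\int_Q\omega(x)dx\right)\left(\operatorname{ess\,inf}_{x\in Q}\omega(x)\right)^{-1}<\infty$. A growth function is a function $\Phi:\mathbb{R}_+\to\mathbb{R}_+$, not identically zero, continuous, nondecreasing and onto. It is of upper-type $q>0$ if there is $C_q>0$ with $\Phi(st)\le C_q t^q\Phi(s)$ for all $s>0$, $t\ge 1$. For $q\ge1$, $\mathcal{U}^q$ is the set of growth functions of upper-type $q$ such that $t\mapsto\Phi(t)/t$ is nondecreasing on $\mathbb{R}_+^*$; $\mathcal{U}=\bigcup_{q\ge1}\mathcal{U}^q$. Standing convention: (up to replacing it by an equivalent function) every $\Phi\in\mathcal{U}$ is assumed convex, of class $C^1$, with $\Phi'(t)\approx\Phi(t)/t$ for $t>0$. $\Phi\in\Delta'$: there is $C>0$ with $\Phi(st)\le C\Phi(s)\Phi(t)$ for all $s,t>0$. For $q\ge1$, $\widetilde{\mathcal{U}}^q$ is the set of $\Phi\in\mathcal{U}^q\cap\Delta'$ for which there is $C>0$ with $\Phi(s/t)\le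 C\,\Phi(s)/t^q$ for all $s,t\ge1$; $\widetilde{\mathcal{U}}=\bigcup_{q\ge1}\widetilde{\mathcal{U}}^q$. *)

(* Defs.v *)
From HB Require Import structures.
From mathcomp Require Import all_boot all_order all_algebra.
From mathcomp Require Import all_classical all_reals all_analysis.

Set Implicit Arguments.
Unset Strict Implicit.
Unset Printing Implicit Defensive.

Import Order.TTheory GRing.Theory Num.Theory.
Import numFieldNormedType.Exports.

Local Open Scope classical_set_scope.
Local Open Scope ring_scope.

(* Lebesgue measure on the Borel sets of R^d, by iterated products: lambda_0 is
   the unit mass at the empty tuple, and lambda_(d+1) is the image of
   lambda_1 \x lambda_d under (x, y) |-> x :: y. *)
Section borel_lebesgue.
Context {R : realType}.

Definition cons_pair d (p : (measurableTypeR R * d.-tuple R)%type) : d.+1.-tuple R :=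
  [tuple of (p.1 : R) :: p.2].

Lemma measurable_cons_pair d : measurable_fun setT (@cons_pair d).
Proof. exact: measurable_cons. Qed.

Section step.
Context {d : nat} (m : {sigma_finite_measure set (d.-tuple R) -> \bar R}).

Definition lebesgue_step : set (d.+1.-tuple R) -> \bar R :=
  pushforward ((@lebesgue_measure R) \x m)%E (@cons_pair d).

HB.instance Definition _ := Measure.copy lebesgue_step
  (measure_function_pushforward__canonical__measure_function_Measure
     ((@lebesgue_measure R) \x m)%E (@measurable_cons_pair d)).

Let lebesgue_step_sigma_finite : sigma_finite setT lebesgue_step.
Proof.
have /sigma_finiteP[F [TF ndF Foo]] := sigma_finiteT (@lebesgue_measure R).
have /sigma_finiteP[G [TG ndG Goo]] := sigma_finiteT m.
pose u (t : d.+1.-tuple R) : (measurableTypeR R * d.-tuple R)%type :=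
  (tnth t ord0, [tuple of behead t]).
have uK p : u (cons_pair p) = p.
  by case: p => x y; congr pair; apply: val_inj.
have mu : measurable_fun setT u.
  apply/measurable_fun_pairP; split => /=.
    exact: (measurable_tnth (T := R) ord0).
  exact: measurable_behead.
exists (fun n => u @^-1` (F n `*` G n)).
  rewrite -preimage_bigcup; apply/esym; rewrite -subTset => t _ /=.
  have [i _ Fi] : (\bigcup_n F n) (u t).1 by rewrite -TF.
  have [j _ Gj] : (\bigcup_n G n) (u t).2 by rewrite -TG.
  exists (maxn i j) => //; split.
    by move/subsetPset: (ndF _ _ (leq_maxl i j)); exact.
  by move/subsetPset: (ndG _ _ (leq_maxr i j)); exact.
move=> n; have [mF Fn] := Foo n; have [mG Gn] := Goo n; split.
  by rewrite -[X in measurable X]setTI; apply: mu => //; exact: measurableX.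
rewrite /lebesgue_step /pushforward -comp_preimage.
rewrite (_ : u \o _ = id); last by apply/funext => p; rewrite /= uK.
by rewrite preimage_id product_measure1E// lte_mul_pinfty// ge0_fin_numE.
Qed.

HB.instance Definition _ := Measure_isSigmaFinite.Build _ _ _ lebesgue_step
  lebesgue_step_sigma_finite.

End step.

Fixpoint borel_lebesgue d : {sigma_finite_measure set (d.-tuple R) -> \bar R} :=
  if d is d'.+1 then lebesgue_step (borel_lebesgue d')
  else \d_([tuple] : 0.-tuple R).

Lemma borel_lebesgue_box d (A : 'I_d -> set R) :
  (forall i, measurable (A i)) ->
  borel_lebesgue d [set x | forall i, A i (tnth x i)] =
  (\prod_(i < d) @lebesgue_measure R (A i))%E.
Proof.
elim: d A => [|d ih] A mA.
  rewrite big_ord0 /= diracE mem_set//= => -[]//.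
rewrite big_ord_recl -ih//= /lebesgue_step /pushforward.
set B := [set x : d.-tuple R | _].
have mB : measurable B.
  rewrite (_ : B = \bigcap_(i in [set: 'I_d])
      ((@tnth d R ^~ i) @^-1` A (lift ord0 i))); last first.
    by apply/seteqP; split => x Bx i; [move=> _|]; exact: Bx.
  apply: fin_bigcap_measurable => // i _.
  by rewrite -[X in measurable X]setTI; exact: measurable_tnth.
rewrite -product_measure1E//; last exact: mA; congr (_ _).
apply/seteqP; split => [[x y] /= h|[x y] /= [h1 h2] i].
  by split; [exact: (h ord0)|move=> i; have := h (lift ord0 i); rewrite tnthS].
by have [j ->|->] := unliftP ord0 i; [rewrite tnthS; exact: h2|exact: h1].
Qed.

End borel_lebesgue.

(* R^d with its sigma-algebra of Lebesgue measurable sets, which contains the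
   Borel one, and the (complete) Lebesgue measure. *)
Definition Rd (R : realType) (d : nat) : measurableType _ :=
  caratheodory_type ((@borel_lebesgue R d)^*)%mu.

Definition lebesgue (R : realType) (d : nat) :
    {measure set (Rd R d) -> \bar R} :=
  @completed_measure_extension _ _ R (@borel_lebesgue R d).

Section weights.
Context {R : realType} {d : nat}.
Implicit Types (w : Rd R d -> R) (Q : set (Rd R d)).

Local Notation mu := (lebesgue R d).

Definition coord (x : Rd R d) (i : 'I_d) : R := tnth (x : d.-tuple R) i.

Definition cube Q := exists (a : 'I_d -> R) (l : R),
  0 < l /\ Q = [set x | forall i, a i <= coord x i <= a i + l].

(* The topology of R^d is that of row vectors, since the library puts none on
   tuples. *)
Definition locally_integrable_Rd w := measurable_fun setT w /\
  forall K : set 'rV[R]_d, compact K ->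
    (\int[mu]_(x in [set x | K (\row_i coord x i)]) `|w x|%:E < +oo)%E.

Definition weight w := locally_integrable_Rd w /\ {ae mu, forall x, 0 < w x}.

Definition wmeasure w Q : \bar R := (\int[mu]_(x in Q) (w x)%:E)%E.

Definition ess_inf_on Q w : \bar R :=
  ereal_sup [set y : \bar R | {ae mu, forall x, Q x -> (y <= (w x)%:E)%E}].

(* With values in \bar R, where 0^-1 = +oo: the supremum is +oo as soon as the
   essential infimum of the weight vanishes on some cube. *)
Definition A1_const w : \bar R :=
  ereal_sup [set (wmeasure w Q / mu Q / ess_inf_on Q w)%E | Q in cube].

Definition A1 w := (A1_const w < +oo)%E.

End weights.

(* Functions R_+ -> R_+ are encoded as functions R -> R of which only the
   values on R_+ matter. *)
Section growth_functions.
Context {R : realType}.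
Implicit Types (Phi : R -> R) (q : R).

Definition Rplus : set R := [set t | 0 <= t].

Definition growth_function Phi :=
  [/\ set_fun Rplus Rplus Phi,
      exists2 t, 0 <= t & Phi t != 0,
      {within Rplus, continuous Phi},
      {in Rplus &, {homo Phi : s t / s <= t}} &
      set_surj Rplus Rplus Phi].

Definition upper_type q Phi := exists2 C : R, 0 < C &
  forall s t, 0 < s -> 1 <= t -> Phi (s * t) <= C * t `^ q * Phi s.

(* The standing normalization of the members of U. Together with convexity on
   R_+, differentiability with continuous derivative on (0, +oo) amounts to
   class C^1 on R_+ with a one-sided derivative at 0. *)
Definition normalized Phi :=
  [/\ convex_function (Rplus : set R^o) Phi,
      forall t, 0 < t -> derivable Phi t 1,
      forall t, 0 < t -> {for t, continuous (derive1 Phi)} &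
      exists c C : R, [/\ 0 < c, 0 < C & forall t, 0 < t ->
        c * (Phi t / t) <= derive1 Phi t <= C * (Phi t / t)]].

Definition class_U q Phi :=
  [/\ growth_function Phi, upper_type q Phi,
      forall s t, 0 < s -> s <= t -> Phi s / s <= Phi t / t &
      normalized Phi].

Definition Delta' Phi := exists2 C : R, 0 < C &
  forall s t, 0 < s -> 0 < t -> Phi (s * t) <= C * Phi s * Phi t.

Definition class_Utilde q Phi :=
  [/\ class_U q Phi, Delta' Phi &
      exists2 C : R, 0 < C &
        forall s t, 1 <= s -> 1 <= t -> Phi (s / t) <= C * Phi s / t `^ q].

Definition Utilde Phi := exists2 q, 1 <= q & class_Utilde q Phi.

Definition inverse Phi : R -> R := 'pinv_(fun=> 0) Rplus Phi.

End growth_functions.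

Definition nu {R : realType} {d n : nat} (Phi : R -> R) (Phis : 'I_n -> R -> R)
    (sigma : 'I_n -> Rd R d -> R) (x : Rd R d) : R :=
  (Phi (\prod_(i < n) inverse (Phis i) (sigma i x)^-1))^-1.

(* Main.v *)
Require Import Defs.
From HB Require Import structures.
From mathcomp Require Import all_boot all_order all_algebra.
From mathcomp Require Import all_classical all_reals all_analysis.
From mathcomp Require Import measurable_realfun ring.

(** The functions of the class Utilde are powers in disguise.  Suppose Phi is
    of upper type q and Phi (s / t) <= C Phi s / t^q for s, t >= 1.  For
    t >= 1, upper type bounds Phi t above by a multiple of t^q, and the second
    condition with s = t bounds it below by one.  For t <= 1 the roles are
    exchanged: upper type applied to 1 = t * (1 / t) bounds Phi t below, and the
    second condition with s = 1 bounds it above.  Hence Phi t is comparable to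
    t^q on the whole half line ([Utilde_power_like]).

    Consequently Phi_i^-1 is comparable to t^(1/q_i), the product Phi^-1 to t^p
    with p = 1/q_1 + ... + 1/q_n, and Phi to t^(1/p).  The expression
    Phi (\prod_i Phi_i^-1 (t_i)) is therefore comparable to the weighted
    geometric mean \prod_i t_i^(w_i), where w_i = (1/q_i)/p and the w_i add up
    to 1 ([Phi_prod_geom_mean]).  The geometric mean is multiplicative and
    homogeneous of degree 1, so up to constants the assertions become statements
    about nu = \prod_i sigma_i^(w_i).

    Assertion (i) is then Hoelder's inequality
    nu(Q) <= \prod_i sigma_i(Q)^(w_i), up to a factor n: the geometric mean of
    the normalized weights sigma_i / sigma_i(Q) is at most their sum, whose
    integral over Q is n ([wmeasure_nu_le]).

    For assertion (ii), the A_1 condition bounds sigma_i below almost everywhere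
    on Q by a multiple of sigma_i(Q) / (|Q| [sigma_i]_A1) ([A1_lower_bound]).
    The geometric mean of these bounds, integrated over Q, gives
    nu(Q) >= c \prod_i sigma_i(Q)^(w_i) / \prod_i [sigma_i]_A1^(w_i)
    ([wmeasure_nu_ge]), and the last denominator is at most the sum of the
    [sigma_i]_A1. *)

Set Implicit Arguments.
Unset Strict Implicit.
Unset Printing Implicit Defensive.

Import Order.TTheory GRing.Theory Num.Theory.
Import numFieldNormedType.Exports.

Local Open Scope classical_set_scope.
Local Open Scope ring_scope.

(** * Functions comparable to a power *)

(** The single constant C bounds from both sides, which keeps products and
    inverses of such functions easy to compare. *)
Definition power_like {R : realType} (p : R) (f : R -> R) :=
  exists2 C : R, 0 < C & forall t, 0 < t -> C^-1 * t `^ p <= f t <= C * t `^ p.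

Section power_like.
Context {R : realType}.
Implicit Types (f g : R -> R) (p q c t : R).

Lemma ler_powRl p s t : 0 <= p -> 0 <= s -> s <= t -> s `^ p <= t `^ p.
Proof.
by move=> p0 s0 st; apply: (ge0_ler_powR p0) => //; rewrite nnegrE ?(le_trans s0).
Qed.

Lemma powRV p t : 0 <= t -> t^-1 `^ p = (t `^ p)^-1.
Proof. by move=> t0; rewrite -(powR_inv1 t0) -powRrM mulN1r powRN. Qed.

(** Raising C^-1 * (g t)^p <= f (g t) = t <= C * (g t)^p to the power 1/p. *)
Lemma power_like_inverse p f g : 0 < p -> power_like p f ->
  (forall t, 0 < t -> 0 < g t) -> (forall t, 0 < t -> f (g t) = t) ->
  power_like p^-1 g.
Proof.
move=> p0 [C C0 fC] g0 fgK.
have pV0 : 0 <= p^-1 by rewrite invr_ge0 ltW.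
have powpK t : 0 <= t -> (t `^ p) `^ p^-1 = t.
  by move=> t0; rewrite -powRrM mulfV ?gt_eqF// powRr1.
exists (C `^ p^-1); first exact: powR_gt0.
move=> t t0; have gt0 := g0 t t0; have := fC _ gt0; rewrite fgK// => /andP[lo up].
rewrite -powRV ?(ltW C0)// -!powRM ?invr_ge0 ?(ltW C0) ?(ltW t0)//.
rewrite -(powpK _ (ltW gt0)); apply/andP; split; apply: ler_powRl => //.
- by rewrite mulr_ge0 ?invr_ge0 ?ltW.
- by rewrite ler_pdivrMl.
- by rewrite powR_ge0.
- by rewrite -ler_pdivrMl.
Qed.

Lemma power_like_gt0 p f t : power_like p f -> 0 < t -> 0 < f t.
Proof.
move=> [C C0 fC] t0; have /andP[+ _] := fC _ t0; apply: lt_le_trans.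
by rewrite mulr_gt0 ?invr_gt0 ?powR_gt0.
Qed.

Lemma power_like_bounds p f (a b : R) : 0 < a -> 0 < b ->
  (forall t, 0 < t -> a * t `^ p <= f t <= b * t `^ p) -> power_like p f.
Proof.
move=> a0 b0 fab; exists (a^-1 + b); first by rewrite addr_gt0 ?invr_gt0.
move=> t t0; have /andP[lo up] := fab _ t0; apply/andP; split.
  apply: le_trans lo; rewrite ler_wpM2r ?powR_ge0//.
  by rewrite -[leRHS]invrK lef_pV2 ?posrE ?addr_gt0 ?invr_gt0// lerDl ltW.
apply: (le_trans up); rewrite ler_wpM2r ?powR_ge0//.
by rewrite lerDr invr_ge0 ltW.
Qed.

(** In the class Utilde, the upper type and the decay condition are converse to
    each other: for each t one of them bounds f t by a multiple of t^q from
    above and the other from below, once f 1 is known to be positive. *)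
Lemma Utilde_power_like f : Utilde f -> exists2 q, 1 <= q & power_like q f.
Proof.
move=> [q q1 [[[f_ge0 [z z0 fz0] _ f_nd _] [A A0 fA] _ _] _ [B B0 fB]]].
exists q => //.
(* If f 1 = 0, upper type with s = 1 makes f vanish on [1, +oo), and
   monotonicity makes it vanish on [0, 1]. *)
have f1 : 0 < f 1.
  rewrite lt_neqAle (f_ge0 1 (ler01 : Rplus 1)) andbT eq_sym.
  apply: contra_neq fz0 => f10; apply/eqP; rewrite eq_le (f_ge0 _ z0) andbT.
  have [z1|/ltW z1] := leP 1 z.
    by have := fA 1 z ltr01 z1; rewrite f10 mulr0 mul1r.
  by rewrite -f10 f_nd// inE /Rplus/=.
have pow_gt0 t : 0 < t -> 0 < t `^ q by exact: powR_gt0.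
apply: (@power_like_bounds _ _ (f 1 / (A + B)) ((A + B) * f 1)).
- by rewrite divr_gt0 ?addr_gt0.
- by rewrite mulr_gt0 ?addr_gt0.
move=> t t0; have [t1|/ltW t1] := leP 1 t.
  apply/andP; split.
    have := fB t t t1 t1; rewrite divff ?gt_eqF// ler_pdivlMr ?pow_gt0// => h.
    rewrite mulrAC ler_pdivrMr ?addr_gt0//; apply: (le_trans h).
    by rewrite mulrC ler_wpM2l ?(f_ge0 _ (ltW t0)) ?lerDr ?ltW.
  have := fA 1 t ltr01 t1; rewrite mul1r => /le_trans; apply.
  rewrite mulrAC -!mulrA mulrC [leRHS]mulrC ler_wpM2l//.
    by rewrite mulr_ge0 ?ltW ?pow_gt0.
  by rewrite lerDl ltW.
have t1' : 1 <= t^-1 by rewrite invf_ge1.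
apply/andP; split.
  have h : f 1 * t `^ q <= A * f t.
    have := fA t t^-1 t0 t1'; rewrite divff ?gt_eqF// (powRV _ (ltW t0)) => h.
    by rewrite -ler_pdivlMr ?pow_gt0// mulrAC.
  rewrite mulrAC ler_pdivrMr ?addr_gt0//; apply: (le_trans h).
  by rewrite mulrC ler_wpM2l ?(f_ge0 _ (ltW t0)) ?lerDl ?ltW.
have := fB 1 t^-1 (lexx _) t1'; rewrite mul1r invrK (powRV _ (ltW t0)) invrK.
move=> /le_trans; apply.
by rewrite ler_wpM2r ?powR_ge0// ler_wpM2r ?(ltW f1)// lerDr ltW.
Qed.

Lemma power_like_prod n (p : 'I_n -> R) (f : 'I_n -> R -> R) :
  (forall i, power_like (p i) (f i)) -> exists2 C, 0 < C &
  forall t : 'I_n -> R, (forall i, 0 < t i) ->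
    C^-1 * (\prod_i t i `^ p i) <= \prod_i f i (t i) <= C * \prod_i t i `^ p i.
Proof.
move=> pf.
have /choice[C C_] : forall i, exists C, 0 < C /\
    forall t, 0 < t -> C^-1 * t `^ p i <= f i t <= C * t `^ p i.
  by move=> i; have [C C0 h] := pf i; exists C.
have C0 i : 0 < C i by have [] := C_ i.
have fC i : forall t, 0 < t -> (C i)^-1 * t `^ p i <= f i t <= C i * t `^ p i.
  by have [] := C_ i.
exists (\prod_i C i); first exact: prodr_gt0.
move=> t t0; rewrite -prodfV -!big_split/=; apply/andP; split; apply: ler_prod.
  move=> i _; rewrite mulr_ge0 ?invr_ge0 ?powR_ge0 ?(ltW (C0 i))//=.
  by have /andP[] := fC i _ (t0 i).
move=> i _; rewrite (ltW (power_like_gt0 (pf i) (t0 i)))/=.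
by have /andP[] := fC i _ (t0 i).
Qed.

End power_like.

(** * Inverses of growth functions *)

Section inverse.
Context {R : realType}.
Implicit Types (f : R -> R) (t : R).

Lemma inverse_ge0 f t : 0 <= inverse f t.
Proof.
rewrite /inverse /pinv_ splitV /= oinv_surj.
by case: pselect => //= tf; case: cid2.
Qed.

Lemma inverseK f t : set_surj Rplus Rplus f -> 0 <= t -> f (inverse f t) = t.
Proof. by move=> fs t0; apply: (surjpK _ fs); rewrite inE. Qed.

End inverse.

(** * Weighted geometric means *)

Section geometric_mean.
Context {R : realType} {n : nat}.
Implicit Types (w t u : 'I_n -> R).

Definition geom_mean w t := \prod_i t i `^ w i.

Lemma geom_mean_gt0 w t : (forall i, 0 < t i) -> 0 < geom_mean w t.
Proof. by move=> t0; apply: prodr_gt0 => i _; exact: powR_gt0. Qed.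

Lemma geom_meanM w t u : (forall i, 0 <= t i) -> (forall i, 0 <= u i) ->
  geom_mean w (fun i => t i * u i) = geom_mean w t * geom_mean w u.
Proof.
by move=> t0 u0; rewrite -big_split; apply: eq_bigr => i _; exact: powRM.
Qed.

Lemma geom_meanV w t : (forall i, 0 <= t i) ->
  geom_mean w (fun i => (t i)^-1) = (geom_mean w t)^-1.
Proof. by move=> t0; rewrite -prodfV; apply: eq_bigr => i _; exact: powRV. Qed.

Lemma ler_geom_mean w t u : (forall i, 0 <= w i) -> (forall i, 0 <= t i) ->
  (forall i, t i <= u i) -> geom_mean w t <= geom_mean w u.
Proof.
move=> w0 t0 tu; apply: ler_prod => i _.
by rewrite powR_ge0/= ler_powRl.
Qed.

Lemma prod_powR (w : 'I_n -> R) (a : R) : 0 < a ->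
  \prod_i a `^ w i = a `^ (\sum_i w i).
Proof.
move=> a0; elim/big_rec2: _ => [|i x y _ ->]; first by rewrite powRr0.
by rewrite powRD// (gt_eqF a0) implybT.
Qed.

Lemma powR_prod t (p : R) : (forall i, 0 <= t i) ->
  (\prod_i t i) `^ p = \prod_i t i `^ p.
Proof.
move=> t0; suff [] : 0 <= \prod_i t i /\ (\prod_i t i) `^ p = \prod_i t i `^ p by [].
elim/big_rec2: _ => [|i x y _ [x0 <-]]; first by rewrite powR1.
by rewrite mulr_ge0// powRM.
Qed.

Lemma geom_mean_cst w (a : R) : \sum_i w i = 1 -> 0 < a ->
  geom_mean w (fun=> a) = a.
Proof. by move=> w1 a0; rewrite /geom_mean prod_powR// w1 powRr1// ltW. Qed.

(** Each t_i is at most the sum S of all of them, and the mean of the constant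
    family S is S. *)
Lemma geom_mean_le_sum w t : (forall i, 0 <= w i) -> \sum_i w i = 1 ->
  (forall i, 0 < t i) -> geom_mean w t <= \sum_i t i.
Proof.
move=> w0 w1 t0.
have tS i : t i <= \sum_j t j.
  by rewrite (bigD1 i)//= lerDl sumr_ge0// => j _; exact: ltW.
have [i _] : exists i : 'I_n, true.
  case: n w w1 {w0 t0 t tS} => [w|m _ _]; last by exists ord0.
  by rewrite big_ord0 => /esym/eqP; rewrite oner_eq0.
rewrite -[leRHS](geom_mean_cst w1); last exact: lt_le_trans (tS i).
by apply: ler_geom_mean => // j; exact: ltW.
Qed.

End geometric_mean.

(** * The functions of the class Utilde and their inverses *)

Section Utilde.
Context {R : realType} (f : R -> R).
Context (fU : Utilde f).

Lemma Utilde_fun : set_fun Rplus Rplus f.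
Proof. by case: fU => q _ [[[]]]. Qed.

Lemma Utilde_surj : set_surj Rplus Rplus f.
Proof. by case: fU => q _ [[[]]]. Qed.

Lemma Utilde_homo s t : 0 <= s -> s <= t -> f s <= f t.
Proof.
case: fU => q _ [[[_ _ _ h _] _ _ _] _ _] s0 st.
by apply: h => //; rewrite inE /Rplus//= (le_trans s0).
Qed.

Lemma Utilde0 : f 0 = 0.
Proof.
have [s s0 fs] : exists2 s, 0 <= s & f s = 0.
  by have [s ? ?] := Utilde_surj (lexx 0 : Rplus 0); exists s.
apply/le_anti/andP; split; last exact: (Utilde_fun (lexx 0 : Rplus 0)).
by rewrite -[leRHS]fs Utilde_homo.
Qed.

Lemma Utilde_inverse_gt0 t : 0 < t -> 0 < inverse f t.
Proof.
move=> t0; rewrite lt_neqAle inverse_ge0 andbT; apply/eqP => ft.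
have := inverseK Utilde_surj (ltW t0); rewrite -ft Utilde0 => t00.
by rewrite -t00 ltxx in t0.
Qed.

Lemma Utilde_inverse_homo : {homo inverse f : s t / s <= t}.
Proof.
(* A negative s is not a value of f on the half line, where the inverse takes
   its default value 0. *)
move=> s t st; have [s0|s0] := leP 0 s; last first.
  rewrite (_ : inverse f s = 0) ?inverse_ge0//.
  rewrite /inverse /pinv_ splitV /= oinv_surj; case: pselect => //= sf.
  by exfalso; case: sf => x x0 fx; move: s0; rewrite -fx ltNge (Utilde_fun x0).
rewrite leNgt; apply/negP => ts; have t0 := le_trans s0 st.
have := Utilde_homo (inverse_ge0 f t) (ltW ts).
rewrite !(inverseK Utilde_surj)// => ts'.
have tse : t = s by apply/le_anti; rewrite ts' st.
by rewrite tse ltxx in ts.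
Qed.

Lemma Utilde_inverse_power_like : exists2 q, 0 < q & power_like q (inverse f).
Proof.
have [q q1 fq] := Utilde_power_like fU; have q0 := lt_le_trans ltr01 q1.
exists q^-1; first by rewrite invr_gt0.
apply: (power_like_inverse q0 fq); first exact: Utilde_inverse_gt0.
by move=> t /ltW t0; exact: inverseK Utilde_surj t0.
Qed.

Lemma Utilde_inverse0 : inverse f 0 = 0.
Proof.
have [q q1 fq] := Utilde_power_like fU.
apply/eqP; rewrite eq_le inverse_ge0 andbT leNgt; apply/negP.
by move=> /(power_like_gt0 fq); rewrite (inverseK Utilde_surj)// ltxx.
Qed.

End Utilde.

(** * The function Phi and the geometric mean *)

Section product.
Context {R : realType} {n : nat} (Phis : 'I_n -> R -> R) (Phi : R -> R).
Context (n_gt0 : (0 < n)%N).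
Context (PhisU : forall i, Utilde (Phis i)).
Context (Phi_bij : set_bij Rplus Rplus Phi).
Context (Phi_inv : forall t : R, 0 <= t ->
  inverse Phi t = \prod_(i < n) inverse (Phis i) t).

Definition Phi_prod (t : 'I_n -> R) := Phi (\prod_i inverse (Phis i) (t i)).

Lemma inverse_PhiK t : 0 <= t -> inverse Phi (Phi t) = t.
Proof. by move=> t0; case: Phi_bij => _ + _ => /pinvKV; apply; rewrite inE. Qed.

Lemma Phi_ge0 t : 0 <= t -> 0 <= Phi t.
Proof. by case: Phi_bij => + _ _; exact. Qed.

Lemma Phi_homo s t : 0 <= s -> s <= t -> Phi s <= Phi t.
Proof.
move=> s0 st; have t0 := le_trans s0 st; rewrite leNgt; apply/negP => ts.
have : t <= s.
  rewrite -(inverse_PhiK t0) -(inverse_PhiK s0) !Phi_inv ?Phi_ge0//.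
  apply: ler_prod => i _; rewrite inverse_ge0/=.
  by apply: Utilde_inverse_homo => //; exact: ltW.
by move=> ts'; move: ts; rewrite (@le_anti _ _ s t) ?ltxx// st.
Qed.

Lemma Phi0 : Phi 0 = 0.
Proof.
case: Phi_bij => _ _ Phi_surj; have := inverseK Phi_surj (lexx 0).
rewrite Phi_inv// (bigD1 (Ordinal n_gt0))//= Utilde_inverse0//.
by rewrite mul0r.
Qed.

Lemma Phi_gt0 t : 0 < t -> 0 < Phi t.
Proof.
move=> t0; rewrite lt_neqAle Phi_ge0 ?(ltW t0)// andbT; apply/eqP => Pt.
have := inverse_PhiK (ltW t0); rewrite -Pt -[X in inverse _ X]Phi0 inverse_PhiK//.
by move=> t00; rewrite -t00 ltxx in t0.
Qed.

Lemma Phi_prod_ge0 t : 0 <= Phi_prod t.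
Proof. by apply: Phi_ge0; apply: prodr_ge0 => i _; exact: inverse_ge0. Qed.

(** With Phi_i^-1 comparable to t^(q_i) and p the sum of the q_i, the function
    Phi^-1 is comparable to t^p, hence Phi to t^(1/p), and the composite to
    (\prod_i t_i^(q_i))^(1/p), the geometric mean of weights q_i / p. *)
Lemma Phi_prod_geom_mean : exists w : 'I_n -> R,
  [/\ forall i, 0 <= w i, \sum_i w i = 1 &
   exists2 C, 0 < C & forall t, (forall i, 0 < t i) ->
     C^-1 * geom_mean w t <= Phi_prod t <= C * geom_mean w t].
Proof.
have /choice[q qP] : forall i, exists q, 0 < q /\ power_like q (inverse (Phis i)).
  by move=> i; have [q ? ?] := Utilde_inverse_power_like (PhisU i); exists q.
have q0 i : 0 < q i by have [] := qP i.
pose p := \sum_i q i.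
have p0 : 0 < p.
  rewrite /p (bigD1 (Ordinal n_gt0))//= ltr_pwDl// sumr_ge0// => i _.
  exact: ltW.
have [C C0 PC] : exists2 C, 0 < C & forall t : 'I_n -> R, (forall i, 0 < t i) ->
    C^-1 * (\prod_i t i `^ q i) <= \prod_i inverse (Phis i) (t i) <=
    C * \prod_i t i `^ q i.
  apply: (@power_like_prod _ n q (fun i => inverse (Phis i))) => i.
  by have [] := qP i.
have invPhi : power_like p (inverse Phi).
  exists C => // t t0; rewrite Phi_inv ?(ltW t0)// -(prod_powR q t0).
  exact: (PC (fun=> t) (fun=> t0)).
have [D D0 PD] : power_like p^-1 Phi.
  apply: (power_like_inverse p0 invPhi); first exact: Phi_gt0.
  by move=> t /ltW; exact: inverse_PhiK.
exists (fun i => q i / p); split.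
- by move=> i; rewrite divr_ge0 ?ltW.
- by rewrite -mulr_suml divff ?gt_eqF.
exists (D * C `^ p^-1); first by rewrite mulr_gt0 ?powR_gt0.
move=> t t0; set X := \prod_i inverse (Phis i) (t i).
have X0 : 0 < X by apply: prodr_gt0 => i _; exact: Utilde_inverse_gt0.
have pV0 : 0 <= p^-1 by rewrite invr_ge0 ltW.
have -> : geom_mean (fun i => q i / p) t = (\prod_i t i `^ q i) `^ p^-1.
  rewrite powR_prod; last by move=> i; exact: powR_ge0.
  by apply: eq_bigr => i _; rewrite powRrM.
have Y0 : 0 <= \prod_i t i `^ q i by apply: prodr_ge0 => i _; exact: powR_ge0.
have /andP[lo up] := PC _ t0.
have /andP[loX upX] := PD _ X0.
apply/andP; split.
  apply: le_trans loX; rewrite invfM -mulrA ler_wpM2l ?invr_ge0 ?(ltW D0)//.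
  rewrite -powRV ?(ltW C0)// -powRM ?invr_ge0 ?(ltW C0)//.
  by rewrite ler_powRl// mulr_ge0 ?invr_ge0 ?(ltW C0).
apply: (le_trans upX); rewrite -mulrA ler_wpM2l ?(ltW D0)//.
by rewrite -powRM ?(ltW C0)// ler_powRl// (ltW X0).
Qed.

End product.

Section reciprocal_bounds.
Context {R : realType} {n : nat} (Phis : 'I_n -> R -> R) (Phi : R -> R).
Context (w : 'I_n -> R) (C : R) (C_gt0 : 0 < C).
Context (PC : forall t, (forall i, 0 < t i) ->
  C^-1 * geom_mean w t <= Phi_prod Phis Phi t <= C * geom_mean w t).

Lemma Phi_prodV_bounds (a : 'I_n -> R) : (forall i, 0 < a i) ->
  C^-1 / geom_mean w a <= Phi_prod Phis Phi (fun i => (a i)^-1) <=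
  C / geom_mean w a.
Proof.
move=> a0; have aV0 i : 0 < (a i)^-1 by rewrite invr_gt0.
by rewrite -geom_meanV ?PC// => i; exact: ltW.
Qed.

Lemma invr_Phi_prodV_bounds (a : 'I_n -> R) : (forall i, 0 < a i) ->
  C^-1 * geom_mean w a <= (Phi_prod Phis Phi (fun i => (a i)^-1))^-1 <=
  C * geom_mean w a.
Proof.
move=> a0; have G0 := geom_mean_gt0 w a0.
have /andP[lo up] := Phi_prodV_bounds a0.
have P0 : 0 < Phi_prod Phis Phi (fun i => (a i)^-1).
  by apply: lt_le_trans lo; rewrite divr_gt0 ?invr_gt0.
have -> : C^-1 * geom_mean w a = (C / geom_mean w a)^-1 by rewrite invfM invrK.
have -> : C * geom_mean w a = (C^-1 / geom_mean w a)^-1 by rewrite invfM !invrK.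
by rewrite !lef_pV2 ?posrE ?divr_gt0 ?invr_gt0// up lo.
Qed.

End reciprocal_bounds.

(** * Measurability *)

Section measurability.
Context {R : realType}.

Lemma measurable_invr : measurable_fun setT (fun t : R => t^-1).
Proof.
rewrite (_ : (fun t => t^-1) =
    fun t => if 0 <= t then t `^ (-1) else - (- t) `^ (-1)); last first.
  apply/funext => t; case: ifPn => [t0|]; first by rewrite powR_inv1.
  by rewrite -ltNge => t0; rewrite powR_inv1 ?oppr_ge0 ?(ltW t0)// invrN opprK.
apply: measurable_fun_ifT.
- by apply: measurable_fun_ler => //; exact: measurable_id.
- exact: measurable_powR.
- apply: measurableT_comp => //.
  rewrite (_ : (fun _ => _) = (@powR R ^~ (-1)) \o -%R)//.
  exact: measurableT_comp.
Qed.

(** A composite of monotone functions with the measurable t^-1.  Only the values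
    of Phi on the half line are monotone, but its argument is nonnegative, so
    Phi may be replaced by t |-> Phi (max 0 t), which is monotone on R. *)
Lemma measurable_invr_Phi_prodV d (T : measurableType d) n
    (Phis : 'I_n -> R -> R) (Phi : R -> R) (s : 'I_n -> T -> R) :
  {in Rplus &, {homo Phi : s t / s <= t}} ->
  (forall i, {homo inverse (Phis i) : s t / s <= t}) ->
  (forall i, measurable_fun setT (s i)) ->
  measurable_fun setT (fun x => (Phi_prod Phis Phi (fun i => (s i x)^-1))^-1).
Proof.
move=> Phi_nd Phis_nd ms; apply: (measurableT_comp measurable_invr).
pose Phi' t := Phi (Num.max 0 t).
have Phi'_nd : {homo Phi' : s t / s <= t}.
  move=> u v uv; have max_ge0 t : Num.max 0 t \in (Rplus : set R).
    by rewrite inE /Rplus/= le_max lexx.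
  apply: Phi_nd; rewrite ?max_ge0//.
  by rewrite ge_max !le_max lexx uv orbT.
rewrite (_ : (fun x => _) =
    Phi' \o (fun x => \prod_i inverse (Phis i) (s i x)^-1)); last first.
  apply/funext => x; rewrite /Phi_prod /Phi'/= max_r// prodr_ge0// => i _.
  exact: inverse_ge0.
apply: measurableT_comp; first exact: nondecreasing_measurable.
apply: measurable_prod => i _.
apply: (@measurableT_comp _ _ _ _ _ _ (inverse (Phis i))).
  exact: nondecreasing_measurable.
exact: (measurableT_comp measurable_invr).
Qed.

End measurability.

(** * Integrals of almost everywhere positive functions *)

Section ae_integral.
Context d (T : measurableType d) {R : realType} (mu : {measure set T -> \bar R}).
Context (D : set T) (w : T -> R).
Context (mD : measurable D) (mw : measurable_fun setT w).
Context (w_gt0 : {ae mu, forall x, 0 < w x}).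

Let mwD : measurable_fun D (EFin \o w).
Proof. by apply/measurable_EFinP; exact: measurable_funTS. Qed.

(** Gives access to the lemmas on integrals of functions that are nonnegative
    at every point. *)
Lemma integral_norm_ae_pos :
  (\int[mu]_(x in D) (w x)%:E = \int[mu]_(x in D) `|w x|%:E)%E.
Proof.
apply: ae_eq_integral => //.
  by apply/measurable_EFinP; apply: measurableT_comp => //; exact: measurable_funTS.
by apply: filterS w_gt0 => x wx _; rewrite gtr0_norm.
Qed.

Lemma integral_ae_pos_ge0 : (0 <= \int[mu]_(x in D) (w x)%:E)%E.
Proof. by rewrite integral_norm_ae_pos integral_ge0// => x _; rewrite lee_fin. Qed.

Lemma integral_ae_pos_gt0 : (0 < mu D)%E -> (0 < \int[mu]_(x in D) (w x)%:E)%E.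
Proof.
move=> D0; rewrite lt_neqAle integral_ae_pos_ge0 andbT; apply/eqP => w0.
have : (\int[mu]_(x in D) `|(w x)%:E| = 0)%E.
  by rewrite [RHS]w0 integral_norm_ae_pos; apply: eq_integral.
move/(ae_eq_integral_abs mu mD mwD) => w_eq0.
move: D0; rewrite (_ : mu D = 0)%E ?ltxx//; apply/negligibleP => //.
have : {ae mu, forall x, ~ D x}.
  apply: filterS2 w_gt0 w_eq0 => x wx h Dx; move: wx.
  by have [->] := h Dx; rewrite ltxx.
apply: negligibleS => x Dx /=; exact.
Qed.

Lemma ae_lower_bound_integral (y : \bar R) :
  {ae mu, forall x, D x -> (y <= (w x)%:E)%E} ->
  (y * mu D <= \int[mu]_(x in D) (w x)%:E)%E.
Proof.
move=> yw; have [y0|/ltW y0] := leP 0%E y; last first.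
  by apply: le_trans integral_ae_pos_ge0; exact: mule_le0_ge0.
rewrite integral_norm_ae_pos -integral_cst//.
apply: ae_ge0_le_integral => //.
- by apply/measurable_EFinP; apply: measurableT_comp => //; exact: measurable_funTS.
- apply: filterS yw => x h Dx; apply: le_trans (h Dx) _.
  by rewrite lee_fin ler_norm.
Qed.

End ae_integral.

(** * Cubes *)

Section cubes.
Context {R : realType} {d : nat}.
Implicit Types (Q : set (Rd R d)) (w : Rd R d -> R).
Local Notation mu := (lebesgue R d).

Lemma measurable_borel_cube (a : 'I_d -> R) (l : R) :
  measurable [set x : d.-tuple R |
    forall i, (`[a i, a i + l]%classic : set R) (tnth x i)].
Proof.
rewrite (_ : [set _ | _] = \bigcap_(i in [set: 'I_d])
    ((@tnth d R ^~ i) @^-1` `[a i, a i + l])); last first.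
  by apply/seteqP; split => x Bx i; [move=> _|]; exact: Bx.
apply: fin_bigcap_measurable => // i _.
by rewrite -[X in measurable X]setTI; apply: measurable_tnth.
Qed.

Lemma measurable_cube Q : cube Q -> measurable Q.
Proof.
move=> [a [l [l0 ->]]].
apply: sub_caratheodory; apply: sub_sigma_algebra.
have := measurable_borel_cube a l; congr measurable.
Qed.

Lemma lebesgue_cube Q : cube Q -> exists2 m : R, 0 < m & mu Q = m%:E.
Proof.
move=> [a [l [l0 ->]]]; exists (l ^+ d); first exact: exprn_gt0.
have -> : [set x : Rd R d | forall i, a i <= Defs.coord x i <= a i + l] =
    [set x : d.-tuple R | forall i, (`[a i, a i + l]%classic : set R) (tnth x i)].
  by apply/seteqP; split => x h i; have := h i; rewrite /Defs.coord /= in_itv/=.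
rewrite /lebesgue /= /completed_measure_extension /= measurable_mu_extE; last first.
  exact: measurable_borel_cube.
rewrite [LHS](@borel_lebesgue_box R d (fun i => `[a i, a i + l]%classic))//.
rewrite (eq_bigr (fun=> l%:E)); last first.
  move=> i _; rewrite lebesgue_measure_itv/= lte_fin ltrDl l0 -EFinB.
  by rewrite addrAC subrr add0r.
by rewrite prodEFin prodr_const card_ord.
Qed.

(** A cube corresponds to a product of segments, which is compact. *)
Lemma wmeasure_cube_fin w Q : weight w -> cube Q -> (wmeasure w Q < +oo)%E.
Proof.
move=> [[mw wloc] w0] cQ; rewrite /wmeasure integral_norm_ae_pos//; last first.
  exact: measurable_cube.
case: cQ => [a [l [l0 QE]]].
have := wloc [set v | forall i, `[a i, a i + l]%classic (v ord0 i)].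
rewrite (_ : [set x : Rd R d | _] = Q); last first.
  rewrite QE; apply/seteqP.
  by split => x h i; have := h i; rewrite /Defs.coord /= in_itv/= mxE.
apply; apply: (@rV_compact R d (fun i => `[a i, a i + l]%classic)) => i.
exact: segment_compact.
Qed.

End cubes.

(** * Weights on cubes and the A_1 condition *)

Section A1.
Context {R : realType} {d : nat}.
Implicit Types (Q : set (Rd R d)) (w : Rd R d -> R).
Local Notation mu := (lebesgue R d).

Lemma wmeasure_cube w Q : weight w -> cube Q ->
  exists2 A : R, 0 < A & wmeasure w Q = A%:E.
Proof.
move=> ww cQ; have [[mw _] w0] := ww.
have [m m0 mQ] := lebesgue_cube cQ.
have := wmeasure_cube_fin ww cQ.
have : (0 < wmeasure w Q)%E.
  by apply: integral_ae_pos_gt0 => //; [exact: measurable_cube|rewrite mQ lte_fin].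
by case: (wmeasure w Q) => [A| |]// A0 _; exists A.
Qed.

(** The A_1 condition on Q reads A / m <= K * ess inf, where A = w(Q) and
    m = |Q|.  The factor 1/2 puts the bound strictly below the essential infimum,
    so that a single almost everywhere lower bound of w dominates it.  The
    average A / m being at least the essential infimum, K >= 1. *)
Lemma A1_lower_bound w Q (A m : R) : weight w -> A1 w -> cube Q ->
  wmeasure w Q = A%:E -> mu Q = m%:E ->
  let K := fine (A1_const w) in
  1 <= K /\ {ae mu, forall x, Q x -> A / m / K / 2 <= w x}.
Proof.
move=> ww wA1 cQ wQ mQ K; have [[mw _] w0] := ww.
have mmQ := measurable_cube cQ.
have m0 : 0 < m by have [m' + ] := lebesgue_cube cQ; rewrite mQ => + [->].
have A0 : 0 < A by have [A' + ] := wmeasure_cube ww cQ; rewrite wQ => + [->].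
have ess_le : (ess_inf_on Q w <= (A / m)%:E)%E.
  apply: ge_ereal_sup => y /= yw.
  have := ae_lower_bound_integral mmQ mw w0 yw.
  by rewrite mQ -/(wmeasure w Q) wQ -lee_pdivlMr// -EFinM.
have ess_ge0 : (0 <= ess_inf_on Q w)%E.
  by apply: ereal_sup_ubound => /=; apply: filterS w0 => x wx _; rewrite lee_fin ltW.
have KQ : (wmeasure w Q / mu Q / ess_inf_on Q w <= A1_const w)%E.
  by apply: ereal_sup_ubound; exists Q.
have Am0 : 0 < A / m by rewrite divr_gt0.
move: KQ; rewrite wQ mQ inver gt_eqF// -EFinM.
case Ee : (ess_inf_on Q w) ess_le ess_ge0 => [e| |]//; rewrite !lee_fin => ess_le ess_ge0.
(* A vanishing essential infimum has inverse +oo, which would make [w]_A1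
   infinite. *)
rewrite inver; case: eqP => [_|/eqP e_neq0].
  by rewrite gt0_muley ?lte_fin// leye_eq => /eqP wy; move: wA1; rewrite /A1 wy ltxx.
have e0 : 0 < e by rewrite lt_neqAle eq_sym e_neq0.
move=> KQ; have KE : A1_const w = K%:E.
  rewrite /K; move: KQ wA1; rewrite /A1.
  by case: (A1_const w) => //.
move: KQ; rewrite KE -EFinM lee_fin => KQ.
have K1 : 1 <= K.
  by apply: le_trans KQ; rewrite ler_pdivlMr// mul1r.
have K0 : 0 < K by exact: lt_le_trans K1.
split => //.
have : ((A / m / K / 2)%:E < ess_inf_on Q w)%E.
  rewrite Ee lte_fin; apply: (@lt_le_trans _ _ (A / m / K)).
    by rewrite ltr_pdivrMr// ltr_pMr ?divr_gt0// ltr1n.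
  by rewrite ler_pdivrMr// [leRHS]mulrC -ler_pdivrMr.
move=> /ereal_sup_gt[y yw ylt]; apply: filterS yw => x h Qx.
by rewrite -lee_fin (le_trans (ltW ylt))// h.
Qed.

End A1.

(** * The measure nu of a cube *)

Section nu.
Context {R : realType} {n : nat} (Phis : 'I_n -> R -> R) (Phi : R -> R).
Context (PhisU : forall i, Utilde (Phis i)).
Context (Phi_bij : set_bij Rplus Rplus Phi).
Context (Phi_inv : forall t : R, 0 <= t ->
  inverse Phi t = \prod_(i < n) inverse (Phis i) t).
Context (w : 'I_n -> R) (C : R).
Context (w_ge0 : forall i, 0 <= w i) (w_sum : \sum_i w i = 1) (C_gt0 : 0 < C).
Context (PC : forall t, (forall i, 0 < t i) ->
  C^-1 * geom_mean w t <= Phi_prod Phis Phi t <= C * geom_mean w t).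
Context {d : nat} (sigma : 'I_n -> Rd R d -> R).
Context (ws : forall i, weight (sigma i)) (Q : set (Rd R d)) (cQ : cube Q).
Context (A : 'I_n -> R) (A0 : forall i, 0 < A i).
Context (AE : forall i, wmeasure (sigma i) Q = (A i)%:E).

Let mQ := measurable_cube cQ.
Let G0 := geom_mean_gt0 w A0.

Lemma nu_ge0 x : 0 <= nu Phi Phis sigma x.
Proof. by rewrite invr_ge0; exact: (Phi_prod_ge0 Phis Phi_bij). Qed.

Lemma measurable_nu : measurable_fun setT (nu Phi Phis sigma).
Proof.
apply: measurable_invr_Phi_prodV.
- by move=> s t; rewrite !inE => s0 _; exact: (Phi_homo PhisU Phi_bij Phi_inv s0).
- by move=> i; exact: Utilde_inverse_homo.
- by move=> i; have [[]] := ws i.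
Qed.

Lemma weights_gt0 : {ae lebesgue R d, forall x, forall i, 0 < sigma i x}.
Proof. by apply: filter_forall => i; have [] := ws i. Qed.

(** Pointwise, nu is at most a constant times geom_mean w A times the geometric
    mean of the sigma_i / A_i, which is at most their sum; each sigma_i / A_i
    has integral 1 over Q. *)
Lemma wmeasure_nu_le :
  (wmeasure (nu Phi Phis sigma) Q <= (C * geom_mean w A * n%:R)%:E)%E.
Proof.
have msigma i : measurable_fun Q (fun x => `|sigma i x|%:E).
  apply/measurable_EFinP; apply: measurableT_comp => //.
  by apply: measurable_funTS; have [[]] := ws i.
have : (\int[lebesgue R d]_(x in Q) (nu Phi Phis sigma x)%:E <=
    \int[lebesgue R d]_(x in Q) ((C * geom_mean w A)%:E *
      \sum_(i < n) ((A i)^-1)%:E * `|sigma i x|%:E))%E.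
  apply: ae_ge0_le_integral => //.
  - by move=> x _; rewrite lee_fin nu_ge0.
  - by apply/measurable_EFinP; apply: measurable_funTS; exact: measurable_nu.
  - move=> x _; rewrite mule_ge0 ?lee_fin ?mulr_ge0 ?(ltW C_gt0) ?(ltW G0)//.
    by rewrite sume_ge0// => i _; rewrite mule_ge0// lee_fin invr_ge0 ltW.
  - apply: measurable_funeM; apply: emeasurable_sum => i.
    exact: measurable_funeM.
  - apply: filterS weights_gt0 => x sx _.
    under eq_bigr do rewrite -EFinM.
    rewrite sumEFin -EFinM lee_fin.
    have /andP[_ /le_trans] := invr_Phi_prodV_bounds C_gt0 PC sx; apply.
    rewrite -mulrA ler_wpM2l ?(ltW C_gt0)//.
    have -> : geom_mean w (fun i => sigma i x) =
        geom_mean w A * geom_mean w (fun i => (A i)^-1 * `|sigma i x|).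
      rewrite -geom_meanM; first last.
      + by move=> i; rewrite mulr_ge0// invr_ge0 ltW.
      + by move=> i; exact: ltW.
      congr geom_mean; apply/funext => i.
      by rewrite mulrA divff ?gt_eqF// mul1r gtr0_norm.
    rewrite ler_wpM2l ?(ltW G0)//; apply: geom_mean_le_sum => // i.
    by rewrite mulr_gt0 ?invr_gt0// normr_gt0 gt_eqF.
move=> /le_trans; apply.
rewrite ge0_integralZl//; first last.
- by rewrite lee_fin mulr_ge0 ?(ltW C_gt0) ?(ltW G0).
- by move=> x _; rewrite sume_ge0// => i _; rewrite mule_ge0// lee_fin invr_ge0 ltW.
- by apply: emeasurable_sum => i; exact: measurable_funeM.
rewrite ge0_integral_sum//; first last.
- by move=> i x _; rewrite mule_ge0// lee_fin invr_ge0 ltW.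
- by move=> i; exact: measurable_funeM.
rewrite (eq_bigr (fun=> 1%E)); last first.
  move=> i _; rewrite ge0_integralZl//; last by rewrite lee_fin invr_ge0 ltW.
  rewrite -integral_norm_ae_pos//; last 2 first.
  + by have [[]] := ws i.
  + by have [] := ws i.
  by rewrite -/(wmeasure _ _) AE -EFinM mulVf ?gt_eqF.
by rewrite sumEFin big_const_ord iter_addr_0 -EFinM.
Qed.

Lemma wmeasure_nu_ge (b : 'I_n -> R) : (forall i, 0 < b i) ->
  (forall i, {ae lebesgue R d, forall x, Q x -> b i <= sigma i x}) ->
  ((C^-1 * geom_mean w b)%:E * lebesgue R d Q <= wmeasure (nu Phi Phis sigma) Q)%E.
Proof.
move=> b0 b_le; have Gb0 := geom_mean_gt0 w b0.
rewrite -integral_cst//.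
apply: ae_ge0_le_integral => //.
- by move=> x _; rewrite lee_fin mulr_ge0 ?invr_ge0 ?(ltW C_gt0) ?(ltW Gb0).
- by move=> x _; rewrite lee_fin nu_ge0.
- by apply/measurable_EFinP; apply: measurable_funTS; exact: measurable_nu.
have bs : {ae lebesgue R d, forall x, forall i, Q x -> b i <= sigma i x}.
  by apply: filter_forall => i; apply: filterS (b_le i) => x.
apply: filterS2 weights_gt0 bs => x sx bx Qx.
rewrite lee_fin; have /andP[+ _] := invr_Phi_prodV_bounds C_gt0 PC sx; apply: le_trans.
rewrite ler_wpM2l ?invr_ge0 ?(ltW C_gt0)//; apply: ler_geom_mean => // i.
- exact: ltW.
- exact: bx.
Qed.

End nu.

Theorem proposition4p11 (R : realType) (n : nat) (n_gt0 : (0 < n)%N)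
    (Phis : 'I_n -> R -> R) (Phi : R -> R)
    (Phis_Utilde : forall i, Utilde (Phis i))
    (Phi_bij : set_bij Rplus Rplus Phi)
    (Phi_inv : forall t : R, 0 <= t ->
      inverse Phi t = \prod_(i < n) inverse (Phis i) t) :
  (exists2 C1 : R, 0 < C1 &
    forall (d : nat) (d_gt0 : (0 < d)%N) (sigma : 'I_n -> Rd R d -> R),
      (forall i, weight (sigma i)) ->
      forall Q : set (Rd R d), cube Q ->
        ((Phi (\prod_(i < n)
             inverse (Phis i) (fine (wmeasure (sigma i) Q))^-1))%:E
           * wmeasure (nu Phi Phis sigma) Q <= C1%:E)%E) /\
  (exists2 C2 : R, 0 < C2 &
    forall (d : nat) (d_gt0 : (0 < d)%N) (sigma : 'I_n -> Rd R d -> R),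
      (forall i, weight (sigma i)) -> (forall i, A1 (sigma i)) ->
      forall Q : set (Rd R d), cube Q ->
        ((C2 / \sum_(i < n) fine (A1_const (sigma i)))%:E
          <= (Phi (\prod_(i < n)
               inverse (Phis i) (fine (wmeasure (sigma i) Q))^-1))%:E
             * wmeasure (nu Phi Phis sigma) Q)%E).
Proof.
have [w [w_ge0 w_sum [C C0 PC]]] :=
  Phi_prod_geom_mean n_gt0 Phis_Utilde Phi_bij Phi_inv.
split.
  exists (C * C * n%:R); first by rewrite !mulr_gt0 ?ltr0n.
  move=> d _ sigma ws Q cQ.
  have /choice[A AP] : forall i, exists A : R, 0 < A /\ wmeasure (sigma i) Q = A%:E.
    by move=> i; have [A ? ?] := wmeasure_cube (ws i) cQ; exists A.
  have A0 i : 0 < A i by have [] := AP i.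
  have AE i : wmeasure (sigma i) Q = (A i)%:E by have [] := AP i.
  have G0 := geom_mean_gt0 w A0.
  under eq_bigr do rewrite AE/=.
  have /andP[_ PA] := Phi_prodV_bounds PC A0.
  apply: (@le_trans _ _ ((C / geom_mean w A)%:E * (C * geom_mean w A * n%:R)%:E)%E).
    apply: lee_pmul.
    - by rewrite lee_fin; exact: (Phi_prod_ge0 Phis Phi_bij).
    - by apply: integral_ge0 => x _; rewrite lee_fin; exact: nu_ge0.
    - by rewrite lee_fin.
    - exact: (wmeasure_nu_le Phis_Utilde Phi_bij Phi_inv w_ge0 w_sum C0 PC ws cQ).
  rewrite -EFinM lee_fin le_eqVlt; apply/orP; left; apply/eqP.
  by field; rewrite gt_eqF.
exists (C^-1 * C^-1 / 2); first by rewrite !mulr_gt0 ?invr_gt0.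
move=> d _ sigma ws wA1 Q cQ.
have /choice[A AP] : forall i, exists A : R, 0 < A /\ wmeasure (sigma i) Q = A%:E.
  by move=> i; have [A ? ?] := wmeasure_cube (ws i) cQ; exists A.
have A0 i : 0 < A i by have [] := AP i.
have AE i : wmeasure (sigma i) Q = (A i)%:E by have [] := AP i.
have G0 := geom_mean_gt0 w A0.
have [m m0 mE] := lebesgue_cube cQ.
(* By the A_1 condition b i bounds sigma_i below on Q; its geometric mean
   carries the factor geom_mean w K, the only trace of the A_1 constants. *)
pose K i := fine (A1_const (sigma i)).
have K1 i : 1 <= K i by have [] := A1_lower_bound (ws i) (wA1 i) cQ (AE i) mE.
have K0 i : 0 < K i by exact: lt_le_trans (K1 i).
pose b i := A i / m / K i / 2.
have b0 i : 0 < b i by rewrite !divr_gt0.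
have GK0 := geom_mean_gt0 w K0.
have bE : geom_mean w b = geom_mean w A / geom_mean w K / (m * 2).
  have -> : b = fun i => (A i * (K i)^-1) * (m * 2)^-1.
    by apply/funext => i; rewrite /b invfM mulrA; congr (_ / _); rewrite mulrAC.
  rewrite !geom_meanM ?geom_meanV ?geom_mean_cst ?invr_gt0 ?mulr_gt0// => i;
    by rewrite ?divr_ge0 ?invr_ge0 ?mulr_ge0// ltW.
have Gb0 := geom_mean_gt0 w b0.
under [X in Phi X]eq_bigr do rewrite AE/=.
have nuQ : ((C^-1 * geom_mean w b)%:E * m%:E <= wmeasure (nu Phi Phis sigma) Q)%E.
  rewrite -mE.
  apply: (wmeasure_nu_ge Phis_Utilde Phi_bij Phi_inv w_ge0 C0 PC ws cQ) => // i.
  by have [] := A1_lower_bound (ws i) (wA1 i) cQ (AE i) mE.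
have /andP[PA _] := Phi_prodV_bounds PC A0.
apply: (@le_trans _ _ ((C^-1 / geom_mean w A)%:E *
    ((C^-1 * geom_mean w b)%:E * m%:E))%E); last first.
  apply: lee_pmul.
  - by rewrite lee_fin divr_ge0 ?invr_ge0 ?ltW.
  - by rewrite -EFinM lee_fin !mulr_ge0 ?invr_ge0 ?ltW.
  - by rewrite lee_fin.
  - exact: nuQ.
rewrite -!EFinM lee_fin bE.
have -> : C^-1 / geom_mean w A *
    (C^-1 * (geom_mean w A / geom_mean w K / (m * 2)) * m) =
    C^-1 * C^-1 / 2 / geom_mean w K.
  by field; rewrite !gt_eqF.
rewrite ler_wpM2l ?mulr_ge0 ?invr_ge0 ?(ltW C0)//.
rewrite lef_pV2 ?posrE//; first exact: geom_mean_le_sum.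
apply: lt_le_trans GK0 _; exact: geom_mean_le_sum.
Qed.
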